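(* Let $m\ge1$ and $k\ge0$ be integers, $\underline\lambda,\underline\rho\in\mathbb{R}^m$ and $\mu,\eta\in\mathbb{R}$. If the $\mathrm{Vect}(M)$-modules $\mathcal{D}^k_{\underline\lambda;\mu}$ and $\mathcal{D}^k_{\underline\rho;\eta}$ are isomorphic, then they have the same shift: $\mu-\sum_{j=1}^m\lambda_j=\eta-\sum_{j=1}^m\rho_j$.
   Context: $M$ is $\mathbb{R}$ or $S^1$. For $\lambda\in\mathbb{R}$, $\mathcal{F}_\lambda$ is the space of smooth $\lambda$-densities $a\,(dx)^\lambda$ on $M$, with the $\mathrm{Vect}(M)$-action $L_X^\lambda(a\,(dx)^\lambda)=(Xa'+\lambda X'a)(dx)^\lambda$ for $X=X(x)\partial_x$. $\mathcal{D}^k_{\underline\lambda;\mu}$ is the space of $m$-ary differential operators of order $\le k$, $A=\sum_{|\underline i|\le k}a_{\underline i}\,\partial_{\underline i}:\mathcal{F}_{\lambda_1}\otimes\cdots\otimes\mathcal{F}_{\lambda_m}\to\mathcal{F}_\mu$, where $\underline i=(i_1,\dots,i_m)$ has non-negative integer entries, $|\underline i|=\sum_ji_j$, $a_{\underline i}$ are smooth functions and $\partial_{\underline i}(\varphi_1,\dots,\varphi_m)=\varphi_1^{(i_1)}\cdots\varphi_m^{(i_m)}$. It is a $\mathrm{Vect}(M)$-module via $L_X^{\underline\lambda;\mu}(A)=L_X^\mu\circ A-\sum_{j=1}^m A(\dots,L_X^{\lambda_j}(-),\dots)$. The shift of $\mathcal{D}^k_{\underline\lambda;\mu}$ is $\delta=\mu-\sum_j\lambda_j$.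 *)

(* Defs.v *)
From HB Require Import structures.
From mathcomp Require Import all_boot all_order all_algebra.
From mathcomp Require Import all_classical all_reals all_analysis.

Set Implicit Arguments.
Unset Strict Implicit.
Unset Printing Implicit Defensive.

Import Order.TTheory GRing.Theory Num.Theory.
Import numFieldNormedType.Exports.

Local Open Scope ring_scope.
Local Open Scope classical_set_scope.

(* The two connected curves R and S^1 = R / 2 pi Z. *)
Inductive curve := line | circle.

(* Real-valued smooth functions on M; those on S^1 are the 2 pi-periodic
   smooth functions of the angular coordinate. *)
Definition smooth_pred (R : realType) (M : curve) : {pred R -> R} :=
  fun f => `[< (forall n x, derivable (derive1n n f) x 1) /\
               (if M is circle then periodic f (pi *+ 2) else True) >].

Section SmoothClosure.
Variable R : realType.
Implicit Types f g : R -> R.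

Fixpoint ndiff n f : Prop :=
  if n is n'.+1 then (forall x, derivable f x 1) /\ ndiff n' (derive1 f) else True.

Lemma ndiffP f : (forall n, ndiff n f) <-> (forall n x, derivable (derive1n n f) x 1).
Proof.
split=> [h n | h n].
  elim: n f h => [|n IHn] f h x; first by case: (h 1%N) => /(_ x).
  by rewrite /derive1n iterSr; apply: IHn => k; case: (h k.+1).
elim: n f h => //= n IHn f h; split=> [x|]; first exact: (h 0%N x).
by apply: IHn => k x; have := h k.+1 x; rewrite /derive1n iterSr.
Qed.

Lemma ndiffW n f : ndiff n.+1 f -> ndiff n f.
Proof. by elim: n f => //= n IHn f [h h']; split=> //; apply: IHn. Qed.

Lemma ndiffD n f g : ndiff n f -> ndiff n g -> ndiff n (f + g).
Proof.
elim: n f g => //= n IHn f g [hf hf'] [hg hg']; split=> [x|].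
  exact: derivableD.
suff -> : derive1 (f + g) = derive1 f + derive1 g by exact: IHn.
by apply/funext => x; rewrite derive1E deriveD // -!derive1E.
Qed.

Lemma ndiffZ n (c : R) f : ndiff n f -> ndiff n (c *: f).
Proof.
elim: n f => //= n IHn f [hf hf']; split=> [x|]; first exact: derivableZ.
suff -> : derive1 (c *: f) = c *: derive1 f by exact: IHn.
by apply/funext => x; rewrite derive1E deriveZ // -!derive1E.
Qed.

Lemma derive1M_fct f g : (forall x, derivable f x 1) ->
  (forall x, derivable g x 1) -> derive1 (f * g) = f * derive1 g + g * derive1 f.
Proof.
by move=> hf hg; apply/funext => x; rewrite derive1E deriveM // -!derive1E.
Qed.

Lemma ndiffM n f g : ndiff n f -> ndiff n g -> ndiff n (f * g).
Proof.
elim: n f g => [//|n IHn] f g hf hg.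
have [df hf'] := hf; have [dg hg'] := hg.
split=> [x|]; first exact: derivableM.
by rewrite derive1M_fct //; apply: ndiffD; apply: IHn => //; apply: ndiffW.
Qed.

Lemma ndiff_cst n (c : R) : ndiff n (cst c).
Proof.
elim: n c => //= n IHn c; split=> [x|]; first exact: derivable_cst.
suff -> : derive1 (cst c : R -> R) = cst 0 by exact: IHn.
by apply/funext => x; rewrite derive1_cst.
Qed.

Lemma periodic_derive1 f T : periodic f T -> periodic (derive1 f) T.
Proof.
move=> pf x; rewrite /derive1.
by under eq_fun do rewrite addrA !pf.
Qed.

End SmoothClosure.

Section Smooth.
Variables (R : realType) (M : curve).

Lemma smooth_predP (f : R -> R) : f \in smooth_pred M <->
  (forall n, ndiff n f) /\ (if M is circle then periodic f (pi *+ 2) else True).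
Proof.
by rewrite unfold_in; split=> [/asboolP [/ndiffP]|[/ndiffP h p]]; last exact/asboolP.
Qed.

Lemma smooth_subring_closed : subring_closed (@smooth_pred R M).
Proof.
split=> [|f g /smooth_predP[hf pf] /smooth_predP[hg pg]
         |f g /smooth_predP[hf pf] /smooth_predP[hg pg]]; apply/smooth_predP.
- by split=> [n|]; [exact: ndiff_cst | case: M].
- split=> [n|].
    by apply: ndiffD => //; rewrite -scaleN1r; apply: ndiffZ.
  by case: M pf pg => // pf pg x; rewrite !fctE pf pg.
- split=> [n|]; first exact: ndiffM.
  by case: M pf pg => // pf pg x; rewrite !fctE pf pg.
Qed.

HB.instance Definition _ :=
  GRing.isSubringClosed.Build (R -> R) (@smooth_pred R M) smooth_subring_closed.

Lemma smooth_scaler_closed : GRing.scaler_closed (@smooth_pred R M).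
Proof.
move=> c f /smooth_predP[hf pf]; apply/smooth_predP; split=> [n|].
  exact: ndiffZ.
by case: M pf => // pf x; rewrite !fctE pf.
Qed.

HB.instance Definition _ :=
  GRing.isScaleClosed.Build R (R -> R) (@smooth_pred R M) smooth_scaler_closed.

Record smooth := Smooth {
  smooth_val :> R -> R;
  smooth_valP : smooth_val \in smooth_pred M }.

HB.instance Definition _ := [isSub for smooth_val].
HB.instance Definition _ := [Choice of smooth by <:].
HB.instance Definition _ := [SubChoice_isSubComNzRing of smooth by <:].
HB.instance Definition _ := [SubZmodule_isSubLmodule of smooth by <:].

Lemma smooth_scalerAl (c : R) (f g : smooth) : c *: (f * g) = c *: f * g.
Proof. by apply/val_inj/funext => x; exact: mulrA. Qed.

HB.instance Definition _ :=
  GRing.Lmodule_isLalgebra.Build R smooth smooth_scalerAl.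
HB.instance Definition _ := GRing.Lalgebra_isComAlgebra.Build R smooth.

End Smooth.

Section Derivation.
Variables (R : realType) (M : curve).
Local Notation C := (smooth R M).

Lemma smooth_deriv_subproof (f : C) : derive1 (f : R -> R) \in smooth_pred M.
Proof.
have /smooth_predP[hf pf] := smooth_valP f; apply/smooth_predP; split=> [n|].
  by case: (hf n.+1).
by case: M f pf {hf} => // f pf; exact: periodic_derive1.
Qed.

Definition smooth_deriv (f : C) : C := Smooth (smooth_deriv_subproof f).

Lemma smooth_derivable (f : C) x : derivable (f : R -> R) x 1.
Proof. by have /smooth_predP[/(_ 1%N)[]] := smooth_valP f. Qed.

Lemma smooth_deriv_is_linear : linear smooth_deriv.
Proof.
move=> c f g; apply/val_inj => /=; apply/funext => x; rewrite !fctE /=.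
rewrite derive1E deriveD; [|exact/derivableZ/smooth_derivable|
  exact: smooth_derivable].
by rewrite deriveZ ?derive1E//; exact: smooth_derivable.
Qed.

HB.instance Definition _ :=
  GRing.isLinear.Build R C C _ smooth_deriv smooth_deriv_is_linear.

Lemma smooth_derivM (f g : C) :
  smooth_deriv (f * g) = smooth_deriv f * g + f * smooth_deriv g.
Proof.
apply/val_inj; rewrite /= derive1M_fct; try exact: smooth_derivable.
by rewrite addrC [X in X + _]mulrC.
Qed.

End Derivation.

(* A density a (dx)^lambda is encoded by its coefficient a, and a vector field
   X(x) d/dx by X, so that F_lambda and Vect(M) are both carried by smooth R M;
   the weight lambda only enters the action. *)
Definition lie_density (R : realType) (M : curve) (lambda : R)
    (X a : smooth R M) : smooth R M :=
  X * smooth_deriv a + lambda *: (smooth_deriv X * a).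

(* Maps with m arguments; d_i (phi_1, ..., phi_m) is the product of the
   derivatives phi_j^(i_j). *)
Definition multiop (R : realType) (M : curve) (m : nat) :=
  ('I_m -> smooth R M) -> smooth R M.

Definition pderiv (R : realType) (M : curve) (m : nat) (i : 'I_m -> nat) :
    multiop R M m :=
  fun phi => \prod_(j < m) iter (i j) (@smooth_deriv R M) (phi j).

(* The multi-indices i with |i| <= k have entries at most k. *)
Definition diffop_pred (R : realType) (M : curve) (m k : nat) :
    {pred multiop R M m} :=
  fun A => `[< exists a : {ffun 'I_m -> 'I_k.+1} -> smooth R M, forall phi,
    A phi = \sum_(i : {ffun 'I_m -> 'I_k.+1} | (\sum_(j < m) i j <= k)%N)
              a i * pderiv (fun j => i j) phi >].

Definition lie_multiop (R : realType) (M : curve) (m : nat)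
    (lambda : 'I_m -> R) (mu : R) (X : smooth R M) (A : multiop R M m) :
    multiop R M m :=
  fun phi => lie_density mu X (A phi) -
    \sum_(j < m) A [eta phi with j |-> lie_density (lambda j) X (phi j)].

Section DiffopClosure.
Variables (R : realType) (M : curve) (m k : nat).
Local Notation C := (smooth R M).
Local Notation D := (@smooth_deriv R M).
Local Notation op := (('I_m -> C) -> C).

HB.instance Definition _ := GRing.Lmodule.copy (multiop R M m) op.

Lemma diffop_predP (A : multiop R M m) : A \in diffop_pred k <->
  exists a : {ffun 'I_m -> 'I_k.+1} -> C, forall phi,
    A phi = \sum_(i : {ffun 'I_m -> 'I_k.+1} | (\sum_(j < m) i j <= k)%N)
              a i * pderiv (fun j => i j) phi.
Proof. by rewrite unfold_in; split=> [/asboolP|?]; last exact/asboolP. Qed.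

Lemma diffop_submod_closed : submod_closed (@diffop_pred R M m k).
Proof.
split; first apply/diffop_predP.
  by exists (fun=> 0) => phi; rewrite big1 // => i _; rewrite mul0r.
move=> c A B /diffop_predP[a Aa] /diffop_predP[b Bb]; apply/diffop_predP.
exists (fun i => c *: a i + b i) => phi; rewrite !fctE Aa Bb.
rewrite scaler_sumr -big_split /=; apply: eq_bigr => i _.
by rewrite mulrDl scalerAl.
Qed.

HB.instance Definition _ :=
  GRing.isSubmodClosed.Build R (multiop R M m) (@diffop_pred R M m k)
    diffop_submod_closed.

Lemma diffop_monomial (a : C) (i : 'I_m -> nat) : (\sum_(j < m) i j <= k)%N ->
  ((fun phi => a * pderiv i phi) : multiop R M m) \in diffop_pred k.
Proof.
move=> ik; apply/diffop_predP.
have ij j : (i j < k.+1)%N.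
  by rewrite ltnS (leq_trans _ ik) // (bigD1 j) //= leq_addr.
pose i0 : {ffun 'I_m -> 'I_k.+1} := [ffun j => Ordinal (ij j)].
have i0E : (fun j => i0 j : nat) = i by apply/funext => j; rewrite ffunE.
exists (fun l => if l == i0 then a else 0) => phi.
rewrite (bigD1 i0) /=; last by under eq_bigr do rewrite ffunE.
rewrite eqxx i0E big1 ?addr0 // => l /andP[_ /negPf ->].
by rewrite mul0r.
Qed.

Lemma smooth_deriv_prod (I : eqType) (r : seq I) (F : I -> C) : uniq r ->
  D (\prod_(j <- r) F j) =
  \sum_(j <- r) D (F j) * \prod_(l <- r | l != j) F l.
Proof.
elim: r => [_|h r IHr /= /andP[hr ur]].
  rewrite !big_nil; have := smooth_derivM (1 : C) 1.
  by rewrite !mulr1 mul1r => /eqP; rewrite -subr_eq0 opprD addNKr oppr_eq0 => /eqP.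
rewrite big_cons smooth_derivM IHr // big_cons; congr (_ + _).
  congr (_ * _); rewrite big_cons eqxx /=.
  rewrite [RHS]big_seq_cond [LHS]big_seq; apply: eq_bigl => l.
  by case: (boolP (l \in r)) => //= lr; apply/esym; apply: contraNneq hr => <-.
rewrite mulr_sumr [LHS]big_seq [RHS]big_seq; apply: eq_bigr => j jr.
rewrite big_cons ifT; first by rewrite mulrCA.
by apply: contraNneq hr => ->.
Qed.

Definition low n (P : C -> C) :=
  exists c : nat -> C, forall f, P f = \sum_(s < n) c s * iter s D f.

Lemma lowD n P Q : low n P -> low n Q -> low n (fun f => P f + Q f).
Proof.
move=> [c Pc] [d Qd]; exists (fun s => c s + d s) => f.
by rewrite Pc Qd -big_split; apply: eq_bigr => s _; rewrite mulrDl.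
Qed.

Lemma low_monomial n (c : C) s : (s < n)%N -> low n (fun f => c * iter s D f).
Proof.
move=> sn; exists (fun t => if t == s then c else 0) => f.
rewrite (bigD1 (Ordinal sn)) //= eqxx big1 ?addr0 // => t ts.
by rewrite ifF ?mul0r //; apply: contraNF ts => /eqP ts; apply/eqP/val_inj.
Qed.

Lemma low_deriv n P : low n P -> low n.+1 (fun f => D (P f)).
Proof.
move=> [c Pc]; exists (fun s => (if (s < n)%N then D (c s) else 0) +
    (if s is t.+1 then c t else 0)) => f.
under [RHS]eq_bigr do rewrite mulrDl.
rewrite big_split /= [X in X + _]big_ord_recr /= ltnn mul0r addr0.
rewrite [X in _ + X]big_ord_recl /= mul0r add0r -big_split /= Pc raddf_sum.
by apply: eq_bigr => s _; rewrite /= smooth_derivM ltn_ord.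
Qed.

Lemma lie_density_low n (lambda : R) (X : C) : low n.+1
  (fun f => X * iter n.+1 D f - iter n D (lie_density lambda X f)).
Proof.
elim: n => [|n IHn].
  have := low_monomial (- (lambda *: D X)) (ltn0Sn 0).
  congr low; apply/funext => f /=.
  by rewrite /lie_density opprD addrA subrr add0r scalerAl mulNr.
have := lowD (low_deriv IHn) (low_monomial (- D X) (ltnSn n.+1)).
congr low; apply/funext => f /=.
by rewrite raddfB /= smooth_derivM mulNr addrAC [D X * _ + _]addrC addrK.
Qed.

Lemma lie_multiop_diffop (lambda : 'I_m -> R) (mu : R) (X : C)
    (A : multiop R M m) :
  A \in diffop_pred k -> lie_multiop lambda mu X A \in diffop_pred k.
Proof.
move=> /diffop_predP[a Aa].
have -> : lie_multiop lambda mu X A =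
    \sum_(i : {ffun 'I_m -> 'I_k.+1} | (\sum_(j < m) i j <= k)%N)
      lie_multiop lambda mu X (fun phi => a i * pderiv (fun j => i j) phi).
  apply/funext => phi; rewrite fct_sumE /lie_multiop sumrB; congr (_ - _).
    rewrite Aa /lie_density raddf_sum /= !mulr_sumr scaler_sumr.
    by rewrite -big_split.
  by rewrite exchange_big /=; apply: eq_bigr => j _; rewrite Aa.
apply: rpred_sum => i ik.
set Q := fun (j : 'I_m) (phi : 'I_m -> C) =>
  \prod_(l < m | l != j) iter (i l) D (phi l).
have QE j s phi : iter s D (phi j) * Q j phi =
    pderiv [eta (fun l => i l : nat) with j |-> s] phi.
  rewrite /pderiv (bigD1 j) //= eqxx; congr (_ * _).
  by apply: eq_bigr => l /negPf lj; rewrite lj.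
have -> : lie_multiop lambda mu X (fun phi => a i * pderiv (fun j => i j) phi) =
    ((fun phi => (X * D (a i) + mu *: (D X * a i)) * pderiv (fun j => i j) phi)
      : multiop R M m) +
    \sum_(j < m) ((fun phi => a i * ((X * iter (i j).+1 D (phi j) -
       iter (i j) D (lie_density (lambda j) X (phi j))) * Q j phi))
       : multiop R M m).
  have addE (f g : multiop R M m) psi : (f + g) psi = f psi + g psi by [].
  apply/funext => phi; rewrite addE fct_sumE /lie_multiop.
  have -> : lie_density mu X (a i * pderiv (fun j => i j) phi) =
      (X * D (a i) + mu *: (D X * a i)) * pderiv (fun j => i j) phi +
      \sum_(j < m) a i * (X * iter (i j).+1 D (phi j) * Q j phi).
    rewrite /lie_density smooth_derivM mulrDr mulrDl -scalerAl !mulrA.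
    rewrite addrAC; congr (_ + _).
    rewrite /pderiv smooth_deriv_prod ?index_enum_uniq // mulr_sumr.
    by apply: eq_bigr => j _; rewrite /Q /= !mulrA; congr (_ * _ * _); exact: mulrC.
  rewrite -addrA -sumrB; congr (_ + _); apply: eq_bigr => j _.
  rewrite -mulrBr mulrBl; congr (_ * (_ - _)).
  rewrite /pderiv (bigD1 j) //= eqxx; congr (_ * _).
  by apply: eq_bigr => l /negPf lj; rewrite lj.
apply: rpredD; first exact: diffop_monomial.
apply: rpred_sum => j _.
have [c cE] := lie_density_low (i j) (lambda j) X.
have -> : ((fun phi => a i * ((X * iter (i j).+1 D (phi j) -
       iter (i j) D (lie_density (lambda j) X (phi j))) * Q j phi))
       : multiop R M m) =
    \sum_(s < (i j).+1) ((fun phi => a i * c s *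
       pderiv [eta (fun l => i l : nat) with j |-> (s : nat)] phi)
       : multiop R M m).
  apply/funext => phi; rewrite fct_sumE cE mulr_suml mulr_sumr.
  by apply: eq_bigr => s _; rewrite -QE !mulrA.
apply: rpred_sum => s _; apply: diffop_monomial.
apply: leq_trans ik; apply: leq_sum => l _ /=.
by case: eqP => [->|//]; rewrite -ltnS.
Qed.

End DiffopClosure.

Section Diffop.
Variables (R : realType) (M : curve) (m k : nat).

(* The vector space underlying D^k_{lambda; mu} does not depend on the
   weights. *)
Record diffop := Diffop {
  diffop_fun :> multiop R M m;
  diffop_funP : diffop_fun \in diffop_pred k }.

HB.instance Definition _ := [isSub for diffop_fun].
HB.instance Definition _ := [Choice of diffop by <:].
HB.instance Definition _ := [SubChoice_isSubLmodule of diffop by <:].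

Definition lie_diffop (lambda : 'I_m -> R) (mu : R) (X : smooth R M)
    (A : diffop) : diffop :=
  Diffop (lie_multiop_diffop lambda mu X (diffop_funP A)).

End Diffop.

(* Isomorphism of Vect(M)-modules V and W with actions actV and actW *)
Definition Vect_isomorphic (R : realType) (M : curve) (V W : lmodType R)
    (actV : smooth R M -> V -> V) (actW : smooth R M -> W -> W) : Prop :=
  exists T : {linear V -> W},
    bijective T /\ forall X v, T (actV X v) = actW X (T v).

(* Main.v *)
(* Fix a vector field s with s(0) = 0, s'(0) = 1.  Consider linear functionals l
   on D^k with l o L_X = 0 whenever X vanishes to second order at 0, with
   l o L_s = c l, and which are not Vect(M)-invariant.  The set of weights c
   that occur is an isomorphism invariant, and its minimum is delta - k:
   - it is attained by the value at 0 of a coefficient of order k;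
   - on a module of densities F_w, a functional with c < w vanishes if w <> 1
     and is invariant if w = 1 (the exception is the integral on the circle,
     for which c = 0).  As the graded pieces of D^k have weights
     delta, ..., delta - k, a functional with c < delta - k vanishes on
     operators of order < k and is therefore invariant on D^k. *)
Require Import Defs.
From HB Require Import structures.
From mathcomp Require Import all_boot all_order all_algebra.
From mathcomp Require Import all_classical all_reals all_analysis.
From mathcomp Require Import ring lra.

Set Implicit Arguments.
Unset Strict Implicit.
Unset Printing Implicit Defensive.

Import Order.TTheory GRing.Theory Num.Theory.

Local Open Scope ring_scope.

(** * Global functions serving as a coordinate at 0 *)

Section Functions.
Variables (R : realType) (M : curve).
Local Notation C := (smooth R M).
Local Notation D := (@smooth_deriv R M).

Lemma derive1_sin_cos :
  derive1 (@sin R) = cos /\ derive1 (@cos R) = (-1) *: (@sin R).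
Proof.
split; apply/funext => x; rewrite derive1E derive_val //.
by rewrite fctE scaleN1r.
Qed.

Lemma ndiff_sin_cos n : ndiff n (@sin R) /\ ndiff n (@cos R).
Proof.
have [ds dc] := derive1_sin_cos.
elim: n => // n [IHs IHc] /=; rewrite ds dc.
split; split=> [x|]; [exact: derivable_sin|exact: IHc|exact: derivable_cos|].
exact: (ndiffZ (-1) IHs).
Qed.

Lemma ndiff_id n : ndiff n (@id R).
Proof.
case: n => // n; split=> [x|]; first exact: derivable_id.
have -> : derive1 (@id R) = cst 1; last exact: ndiff_cst.
by apply/funext => x; rewrite derive1E derive_id.
Qed.

(** Every smooth function on the circle has a critical point, so one function is not enough: [t] is
    added to make the derivatives of [s] and [t] generate the unit ideal. The pair is [x], 0 on the
    line and [sin], [cos] on the circle. *)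
Lemma smooth_coordinate : exists s t : C,
  [/\ s 0 = 0, D s 0 = 1 & D s * D s + D t * D t = 1].
Proof.
case: M.
- have idP : @id R \in smooth_pred line.
    by apply/smooth_predP; split=> // n; exact: ndiff_id.
  have D1 : smooth_deriv (Smooth idP) = 1.
    by apply/val_inj/funext => x /=; rewrite derive1E derive_id.
  exists (Smooth idP), 0; split=> //; first by rewrite D1.
  by rewrite D1 raddf0 mulr0 addr0 mulr1.
- have sP : @sin R \in smooth_pred circle.
    apply/smooth_predP; split=> [n|]; last exact: sinD2pi.
    by case: (ndiff_sin_cos n).
  have cP : @cos R \in smooth_pred circle.
    apply/smooth_predP; split=> [n|]; last exact: cosD2pi.
    by case: (ndiff_sin_cos n).
  have [ds dc] := derive1_sin_cos.
  exists (Smooth sP), (Smooth cP); split=> /=; first exact: sin0.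
    by rewrite ds cos0.
  apply/val_inj/funext => x.
  rewrite -[LHS]/(derive1 sin x * derive1 sin x + derive1 cos x * derive1 cos x).
  by rewrite ds dc fctE scaleN1r mulrNN -!expr2 cos2Dsin2.
Qed.

Lemma smooth_derivD (f g : C) : D (f + g) = D f + D g.
Proof. exact: linearD. Qed.

Lemma smooth_derivB (f g : C) : D (f - g) = D f - D g.
Proof. exact: linearB. Qed.

Lemma smooth_derivZ (c : R) (f : C) : D (c *: f) = c *: D f.
Proof. exact: linearZ. Qed.

Lemma smooth_derivB_val (f g : C) x : D (f - g) x = D f x - D g x.
Proof. by rewrite smooth_derivB. Qed.

Lemma smooth_derivZ_val (c : R) (f : C) x : D (c *: f) x = c * D f x.
Proof. by rewrite smooth_derivZ. Qed.

Lemma smooth_derivM_val (f g : C) x :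
  D (f * g) x = D f x * g x + f x * D g x.
Proof. by rewrite smooth_derivM. Qed.

Lemma smooth_deriv1 : D 1 = 0.
Proof.
have := smooth_derivM (1 : C) 1; rewrite !mulr1 mul1r => /eqP.
by rewrite -subr_eq subrr => /eqP <-.
Qed.

Lemma lie_densityE (lambda : R) (X a : C) :
  lie_density lambda X a = X * D a + lambda%:A * (D X * a).
Proof. by rewrite mulr_algl. Qed.

(** * Functionals on a module of densities *)

Section Densities.
Variables s t : C.
Hypotheses (s0 : s 0 = 0) (s1 : D s 0 = 1) (st : D s * D s + D t * D t = 1).

(** [l] is shown to kill functions vanishing to second order, then [s], then [1]. On the last two
    the field [s] acts, modulo what is already killed, with weights [lambda + 1] and [lambda], both
    larger than [c]. *)
Lemma density_functional_eq0 (lambda c : R) (l : {scalar C}) :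
  (forall X a : C, X 0 = 0 -> D X 0 = 0 -> l (lie_density lambda X a) = 0) ->
  (forall a, l (lie_density lambda s a) = c * l a) ->
  c < lambda -> lambda != 1 -> forall a, l a = 0.
Proof.
move=> l2 ls cl l1.
have lI (X f a : C) : X 0 = 0 -> D X 0 = 0 -> l (X * D f * a) = 0.
  (* Up to the factor [1 - lambda], the product is a difference of Lie derivatives along [X] and
     [f * X], both of which vanish to second order. *)
  move=> X0 X1; have e : (1 - lambda) *: (X * D f * a) =
      lie_density lambda X (f * a) - lie_density lambda (f * X) a.
    rewrite !lie_densityE !smooth_derivM -[LHS]mulr_algl scalerBl scale1r.
    by move: lambda%:A (D X) (D f) (D a) => z x1 f1 a1; ring.
  have fX0 : (f * X) 0 = 0 by rewrite -[LHS]/(f 0 * X 0) X0 mulr0.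
  have fX1 : D (f * X) 0 = 0.
    by rewrite smooth_derivM_val X0 X1 !mulr0 addr0.
  have /eqP : (1 - lambda) * l (X * D f * a) = 0.
    by rewrite -[LHS]linearZ e linearB /= !l2 // subrr.
  by rewrite mulf_eq0 subr_eq0 eq_sym (negPf l1) => /eqP.
have lJ (X : C) : X 0 = 0 -> D X 0 = 0 -> l X = 0.
  (* [st] splits [X] into two products of the form treated by [lI]. *)
  move=> X0 X1; have -> : X = X * D s * D s + X * D t * D t.
    by rewrite -!mulrA -mulrDr st mulr1.
  by rewrite linearD /= !lI // addr0.
have lss : l s = 0.
  have := ls s; have -> : lie_density lambda s s =
      (1 + lambda) *: s + (1 + lambda) *: (s * D s - s).
    rewrite /lie_density -scalerDr addrCA subrr addr0 scalerDl scale1r.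
    by rewrite [D s * s]mulrC.
  rewrite linearD !linearZ /= [l (_ - _)]lJ ?mulr0 ?addr0.
  - move/eqP; rewrite -subr_eq0 -mulrBl mulf_eq0 => /orP[|/eqP//].
    by rewrite subr_eq0 => /eqP e; move: cl; rewrite -e; lra.
  - by rewrite -[LHS]/(s 0 * D s 0 - s 0) s0 mul0r subrr.
  - by rewrite smooth_derivB_val smooth_derivM_val s1 s0; lra.
have lK (X : C) : X 0 = 0 -> l X = 0.
  move=> X0; have -> : X = D X 0 *: s + (X - D X 0 *: s).
    by rewrite addrCA subrr addr0.
  rewrite linearD linearZ /= lss mulr0 add0r lJ //.
    by rewrite -[LHS]/(X 0 - D X 0 * s 0) X0 s0 mulr0 subrr.
  by rewrite smooth_derivB_val smooth_derivZ_val s1 mulr1 subrr.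
have lone : l 1 = 0.
  have := ls 1; have -> : lie_density lambda s 1 =
      lambda *: 1 + lambda *: (D s - 1).
    by rewrite /lie_density smooth_deriv1 mulr0 add0r mulr1 -scalerDr addrCA subrr addr0.
  rewrite linearD !linearZ /= [l (_ - _)]lK; last first.
    by rewrite -[LHS]/(D s 0 - 1) s1 subrr.
  rewrite mulr0 addr0 => /eqP; rewrite -subr_eq0 -mulrBl mulf_eq0.
  by case/orP=> [|/eqP//]; rewrite subr_eq0 => /eqP e; move: cl; rewrite e ltxx.
move=> a; have -> : a = a 0 *: 1 + (a - a 0 *: 1) by rewrite addrCA subrr addr0.
rewrite linearD linearZ /= lone mulr0 add0r [l (_ - _)]lK //.
by rewrite -[LHS]/(a 0 - a 0 * 1) mulr1 subrr.
Qed.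

(* On the circle [l] may be a multiple of the integral, which is why only its
   invariance can be asserted. *)
Lemma one_density_functional_invariant (c : R) (l : {scalar C}) :
  (forall X a : C, X 0 = 0 -> D X 0 = 0 -> l (lie_density 1 X a) = 0) ->
  (forall a, l (lie_density 1 s a) = c * l a) ->
  c < 1 -> forall X a, l (lie_density 1 X a) = 0.
Proof.
move=> l2 ls cl.
have LE (X a : C) : lie_density 1 X a = D (X * a).
  by rewrite /lie_density scale1r smooth_derivM addrC.
have lD (X : C) : X 0 = 0 -> D X 0 = 0 -> l (D X) = 0.
  by move=> X0 X1; rewrite -[X]mulr1 -LE l2.
(* Since [s * D s - s] vanishes to second order, [D s] behaves under [l] as an eigenvector of weight
   1, which differs from [c]. *)
have lDs : l (D s) = 0.
  have := ls (D s); rewrite LE.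
  have -> : s * D s = s + (s * D s - s) by rewrite addrCA subrr addr0.
  rewrite smooth_derivD linearD [X in _ + X]lD ?addr0.
  - move=> /eqP; rewrite -subr_eq0 -{1}[l _]mul1r -mulrBl mulf_eq0.
    case/orP=> [|/eqP//]; rewrite subr_eq0 => /eqP e.
    by move: cl; rewrite -e ltxx.
  - by rewrite -[LHS]/(s 0 * D s 0 - s 0) s0 mul0r subrr.
  - by rewrite smooth_derivB_val smooth_derivM_val s1 s0; lra.
have lDa (u v : R) (Z : C) : l (D (u *: 1 + v *: s + Z)) = l (D Z).
  rewrite !smooth_derivD !smooth_derivZ smooth_deriv1 scaler0 add0r.
  by rewrite linearD linearZ /= lDs mulr0 add0r.
(* [l \o D] kills [1], [s] and all that vanishes to second order, so it remains to subtract the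
   1-jet of [Y] at 0. *)
move=> X a; rewrite LE; move: (X * a) => Y.
have -> : Y = Y 0 *: 1 + D Y 0 *: s + (Y - (Y 0 *: 1 + D Y 0 *: s)).
  by rewrite addrCA subrr addr0.
rewrite lDa lD //.
  by rewrite -[LHS]/(Y 0 - (Y 0 * 1 + D Y 0 * s 0)) s0; lra.
rewrite smooth_derivB smooth_derivD !smooth_derivZ smooth_deriv1.
by rewrite -[LHS]/(D Y 0 - (Y 0 * 0 + D Y 0 * D s 0)) s1; lra.
Qed.

(** A general factor [g] lets the induction close: differentiating [s ^+ k.+1 * g] leaves [s ^+ k]
    times a function with value [k.+1%:R * g 0] at 0. *)
Lemma deriv_pow_mul0 n k (g : C) : (n <= k)%N ->
  iter n D (s ^+ k * g) 0 = (n == k)%:R * n`!%:R * g 0.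
Proof.
elim: n k g => [|n IHn] [|k] g nk //.
- by rewrite [iter 0 D _]/= expr0 mul1r fact0 !mul1r.
- by rewrite [iter 0 D _]/= exprS -mulrA -[LHS]/(s 0 * (s ^+ k * g) 0) s0 !mul0r.
have DX j : D (s ^+ j.+1) = (j.+1%:R * D s) * s ^+ j.
  elim: j => [|j IHj]; first by rewrite expr1 expr0 mul1r mulr1.
  rewrite exprS smooth_derivM IHj -(natr1 j.+1) !exprS.
  by move: (D s) (s ^+ j) => s' sj; ring.
rewrite iterSr smooth_derivM DX.
have -> : k.+1%:R * D s * s ^+ k * g + s ^+ k.+1 * D g =
    s ^+ k * (k.+1%:R * D s * g + s * D g).
  by rewrite exprS; move: (D s) (D g) (s ^+ k) => s' g' sk; ring.
rewrite IHn // eqSS factS natrM.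
have -> : (k.+1%:R * D s * g + s * D g) 0 = k.+1%:R * g 0.
  rewrite mulr_natl -[LHS]/((D s *+ k.+1) 0 * g 0 + s 0 * D g 0).
  by rewrite s0 mul0r addr0 -scaler_nat -[_ 0]/(k.+1%:R * D s 0) s1 mulr1.
by case: eqP => [->|_]; rewrite /= ?mul0r //; ring.
Qed.
End Densities.
End Functions.

(** * Monomial operators and their principal symbols *)

Section Operators.
Variables (R : realType) (M : curve) (m k : nat).
Local Notation C := (smooth R M).
Local Notation D := (@smooth_deriv R M).
Local Notation order i := (\sum_(j < m) i j)%N.

(** To leading order, the [n]-th derivative of a [lambda]-density transforms as a density of weight
    [lambda + n]: each further derivative contributes one more [D X], and the terms with [D (D X)]
    go into the remainder of order below [n]. *)
Lemma lie_density_symbol n (lambda : R) (X : C) : low n (fun f : C =>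
  X * iter n.+1 D f - iter n D (lie_density lambda X f) +
  (lambda + n%:R) *: (D X * iter n D f)).
Proof.
elim: n => [|n IHn].
  exists (fun=> 0) => f; rewrite big_ord0 /= /lie_density addr0.
  by rewrite opprD addrA subrr add0r addNr.
have := lowD (low_deriv IHn)
  (low_monomial (- ((lambda + n%:R) *: D (D X))) (ltnSn n)).
congr low; apply/funext => f; rewrite -natr1 addrA [in RHS]scalerDl scale1r.
rewrite smooth_derivD smooth_derivB smooth_derivZ !smooth_derivM scalerDr.
rewrite mulNr -scalerAl !iterS.
move: (_ *: _) (_ *: _) (D (iter n D (lie_density lambda X f))) => u v w.
by move: (D X) (D (D (iter n D f))) (D (iter n D f)) => X' f2 f1; ring.
Qed.

(** The default 0 above order [k] makes [monomial i] linear in the coefficient for every [i], so it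
    composes with functionals without side conditions. *)
Definition monomial (i : 'I_m -> nat) (a : C) : diffop R M m k :=
  if (order i <= k)%N then insubd 0 (fun phi => a * pderiv i phi) else 0.

Lemma monomialE (i : 'I_m -> nat) (a : C) : (order i <= k)%N ->
  (monomial i a : multiop R M m) = fun phi => a * pderiv i phi.
Proof.
move=> ik; rewrite /monomial ik -[LHS]/(val _) insubdK //.
exact: diffop_monomial.
Qed.

Lemma monomial_is_linear i : linear (monomial i).
Proof.
move=> u a b; case: (leqP (order i) k) => ik; last first.
  by rewrite /monomial leqNgt ik /= scaler0 addr0.
apply/val_inj/funext => phi /=; rewrite monomialE //.
rewrite -[RHS]/(u *: (monomial i a : multiop R M m) phi + (monomial i b : multiop R M m) phi).
by rewrite !monomialE // mulrDl scalerAl.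
Qed.

HB.instance Definition _ i :=
  GRing.isLinear.Build R C (diffop R M m k) _ (monomial i) (monomial_is_linear i).

Lemma diffop_sumE (I : Type) (r : seq I) (P : pred I) (F : I -> diffop R M m k)
    phi :
  diffop_fun (\sum_(i <- r | P i) F i) phi =
  \sum_(i <- r | P i) diffop_fun (F i) phi.
Proof. exact: (big_morph (fun A : diffop R M m k => diffop_fun A phi)). Qed.

Lemma diffop_monomials (A : diffop R M m k) :
  exists a : {ffun 'I_m -> 'I_k.+1} -> C,
  A = \sum_(i : {ffun 'I_m -> 'I_k.+1} | (order i <= k)%N)
        monomial (fun j => i j) (a i).
Proof.
have /diffop_predP[a aE] := diffop_funP A; exists a.
apply/val_inj/funext => phi /=; rewrite aE diffop_sumE.
by apply: eq_bigr => i ik; rewrite monomialE.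
Qed.

Section Action.
Variables (lambda : 'I_m -> R) (mu : R).
Local Notation L := (@lie_diffop R M m k lambda mu).
Local Notation delta := (mu - \sum_(j < m) lambda j).

Lemma lie_diffopD (X : C) : {morph L X : A B / A + B}.
Proof.
move=> A B; apply/val_inj/funext => phi.
have addE A' B' phi' : diffop_fun (A' + B') phi' =
  diffop_fun A' phi' + diffop_fun B' phi' by [].
suff: lie_multiop lambda mu X (diffop_fun (A + B)) phi =
    lie_multiop lambda mu X A phi + lie_multiop lambda mu X B phi by [].
rewrite /lie_multiop addE; under eq_bigr do rewrite addE.
have -> u v : lie_density mu X (u + v) = lie_density mu X u + lie_density mu X v.
  by rewrite /lie_density smooth_derivD !mulrDr scalerDr addrACA.
by rewrite big_split /= opprD addrACA.
Qed.

Lemma lie_diffop0 (X : C) : L X 0 = 0.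
Proof. by apply: (addIr (L X 0)); rewrite -lie_diffopD !add0r. Qed.

Lemma lie_diffop_sum (X : C) (I : Type) (r : seq I) (P : pred I)
    (F : I -> diffop R M m k) :
  L X (\sum_(i <- r | P i) F i) = \sum_(i <- r | P i) L X (F i).
Proof. by apply: big_morph; [exact: lie_diffopD | exact: lie_diffop0]. Qed.

(* The principal symbol of an operator of order [n] is a density of weight
   [delta - n]. *)
Lemma lie_diffop_monomial (X : C) (i : 'I_m -> nat) (a : C) :
  (order i <= k)%N -> exists c : 'I_m -> nat -> C,
  L X (monomial i a) =
    monomial i (lie_density (delta - (order i)%:R) X a) +
    \sum_(j < m) \sum_(s < i j) monomial [eta i with j |-> s : nat] (c j s).
Proof.
move=> ik.
have /choice[c cE] : forall j, exists c : nat -> C, forall f : C,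
    X * iter (i j).+1 D f - iter (i j) D (lie_density (lambda j) X f) +
    (lambda j + (i j)%:R) *: (D X * iter (i j) D f) =
    \sum_(s < i j) c s * iter s D f.
  by move=> j; exact: lie_density_symbol.
exists (fun j s => a * c j s); apply/val_inj/funext => phi /=.
rewrite -[RHS]/(diffop_fun (monomial i _) phi +
  diffop_fun (\sum_(j < m) _) phi).
rewrite /lie_multiop monomialE // monomialE // diffop_sumE.
(* The action changes one argument at a time; [Q j] is the part of the product that stays fixed. *)
pose Q (j : 'I_m) := \prod_(l < m | l != j) iter (i l) D (phi l).
have QP j (i' : 'I_m -> nat) (phi' : 'I_m -> C) :
    (forall l, l != j -> i' l = i l) -> (forall l, l != j -> phi' l = phi l) ->
    pderiv i' phi' = iter (i' j) D (phi' j) * Q j.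
  move=> ei ep; rewrite /pderiv (bigD1 j) //=; congr (_ * _).
  by apply: eq_bigr => l lj; rewrite ei // ep.
have -> : \sum_(j < m) diffop_fun
      (\sum_(s < i j) monomial [eta i with j |-> s : nat] (a * c j s)) phi =
    \sum_(j < m) (a * (X * iter (i j).+1 D (phi j) * Q j) -
      a * (iter (i j) D (lie_density (lambda j) X (phi j)) * Q j) +
      (lambda j + (i j)%:R) *: (D X * a * pderiv i phi)).
  apply: eq_bigr => j _; rewrite diffop_sumE.
  transitivity (a * (\sum_(s < i j) c j s * iter s D (phi j)) * Q j).
    rewrite mulr_sumr mulr_suml; apply: eq_bigr => s _.
    rewrite monomialE; last first.
      apply: leq_trans ik; apply: leq_sum => l _ /=.
      by case: eqP => [->|//]; exact: ltnW.
    rewrite (QP j) //=; last by move=> l /negPf ->.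
    by rewrite eqxx !mulrA.
  rewrite -cE (QP j) // mulrDr mulrDl mulrBr mulrBl -scalerAr -scalerAl.
  congr (_ - _ + _ *: _); rewrite ?mulrA //.
  by rewrite [a * D X]mulrC.
(* Summed over [j], the numbers [lambda j + (i j)%:R] give [mu] minus the weight of the symbol. *)
rewrite big_split sumrB /= -scaler_suml big_split /= -natr_sum.
have -> : \sum_(j < m) a * pderiv i [eta phi with j |-> lie_density (lambda j) X (phi j)] =
    \sum_(j < m) a * (iter (i j) D (lie_density (lambda j) X (phi j)) * Q j).
  apply: eq_bigr => j _; congr (_ * _).
  by rewrite (QP j) //= ?eqxx // => l /negPf ->.
have -> : lie_density mu X (a * pderiv i phi) =
    (X * D a + mu *: (D X * a)) * pderiv i phi +
    \sum_(j < m) a * (X * iter (i j).+1 D (phi j) * Q j).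
  rewrite /lie_density smooth_derivM mulrDr mulrDl -scalerAl !mulrA addrAC.
  congr (_ + _); rewrite /pderiv smooth_deriv_prod ?index_enum_uniq // mulr_sumr.
  by apply: eq_bigr => j _; rewrite /Q /= [X * a]mulrC !mulrA.
rewrite /lie_density !scalerBl !mulrDl !mulNr -!scalerAl scalerDl.
move: (\sum_(j < m) _ : C) (\sum_(j < m) _ : C) => S T.
move: (_ *: _) (_ *: _) (_ *: _) (X * D a * _) => u v w x.
by ring.
Qed.

Lemma order_lower (i : 'I_m -> nat) (j : 'I_m) (s : 'I_(i j)) :
  (order [eta i with j |-> s : nat] < order i)%N.
Proof.
rewrite (bigD1 j) //= eqxx [X in (_ < X)%N](bigD1 j) //= -addSn leq_add //.
by apply: leq_sum => l /negPf ->.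
Qed.

(** All correction terms have order below that of [i]. This turns a functional on operators into one
    on densities, order by order. *)
Lemma functional_lie_monomial (l : {scalar diffop R M m k}) (X : C)
    (i : 'I_m -> nat) (a : C) : (order i <= k)%N ->
  (forall i' b, (order i' < order i)%N -> l (monomial i' b) = 0) ->
  l (L X (monomial i a)) =
  l (monomial i (lie_density (delta - (order i)%:R) X a)).
Proof.
move=> ik l0; have [c ->] := lie_diffop_monomial X a ik.
rewrite linearD (_ : l (\sum_(j < m) _) = 0) ?addr0 // linear_sum big1 // => j _.
by rewrite linear_sum big1 // => s _; rewrite l0 // order_lower.
Qed.

(** * Weights of functionals on operators *)

Section Functionals.
Variables s t : C.
Hypotheses (s0 : s 0 = 0) (s1 : D s 0 = 1) (st : D s * D s + D t * D t = 1).

Lemma functional_weight_ge (l : {scalar diffop R M m k}) (c : R) :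
  (forall (X : C) A, X 0 = 0 -> D X 0 = 0 -> l (L X A) = 0) ->
  (forall A, l (L s A) = c * l A) ->
  (exists X A, l (L X A) != 0) -> delta - k%:R <= c.
Proof.
move=> l2 ls [X [A /negP]]; rewrite leNgt => lXA; apply/negP => ck; apply: lXA.
have dens (i : 'I_m -> nat) : (order i <= k)%N ->
    (forall i' b, (order i' < order i)%N -> l (monomial i' b) = 0) ->
    let w := delta - (order i)%:R in let li := l \o monomial i in
    (forall Y b : C, Y 0 = 0 -> D Y 0 = 0 -> li (lie_density w Y b) = 0) /\
    (forall b, li (lie_density w s b) = c * li b).
  move=> ik l0 /=; split=> [Y b Y0 Y1|b].
    by rewrite -(functional_lie_monomial _ _ ik l0) l2.
  by rewrite -(functional_lie_monomial _ _ ik l0) ls.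
have ltc (i : 'I_m -> nat) : (order i <= k)%N -> c < delta - (order i)%:R.
  by move=> ik; apply: lt_le_trans ck _; rewrite lerD2l lerN2 ler_nat.
(* Strong induction: once the lower orders are killed, [dens] applies at order [n]. *)
have l0 n : (n < k)%N -> forall i b, order i = n -> l (monomial i b) = 0.
  elim/ltn_ind: n => n IHn nk i b ni.
  have ik : (order i <= k)%N by rewrite ni ltnW.
  have [|d2 ds] := dens i ik.
    move=> i' b' i'n; apply: (IHn (order i')); rewrite // -?ni //.
    by rewrite (ltn_trans i'n) // ni.
  have [d1|d1] := eqVneq (delta - (order i)%:R) 1; last first.
    exact: (density_functional_eq0 s0 s1 st d2 ds (ltc _ ik) d1).
  (* Weight 1 at an order below [k] forces [delta - k%:R <= 0]. An invariant functional with nonzero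
     eigenvalue [c] then vanishes. *)
  have c0 : c < 0.
    apply: lt_le_trans ck _.
    have : n.+1%:R <= k%:R :> R by rewrite ler_nat.
    by rewrite -natr1 -ni; move: d1; lra.
  have inv := one_density_functional_invariant s0 s1 (l := l \o monomial i) (c := c).
  rewrite d1 in d2 ds.
  have := ds b; rewrite inv //; last by rewrite (lt_trans c0).
  by move/esym/eqP; rewrite mulf_eq0 (lt_eqF c0) => /eqP.
(* At order [k] the sign of [c] is not controlled if the weight is 1, so only invariance is claimed;
   it already contradicts the choice of [X] and [A]. *)
have lT i b : (order i <= k)%N -> l (L X (monomial i b)) = 0.
  move=> ik.
  have li' i' b' : (order i' < order i)%N -> l (monomial i' b') = 0.
    by move=> i'i; apply: (l0 (order i')) => //; exact: leq_trans ik.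
  rewrite functional_lie_monomial //.
  move: ik; rewrite leq_eqVlt => /orP[/eqP ik|ik]; last exact: (l0 _ ik).
  have [|//|d2 ds] := dens i; first by rewrite ik.
  have cl := ltc i; rewrite ik leqnn in cl.
  have [d1|d1] := eqVneq (delta - (order i)%:R) 1.
    rewrite d1 in d2 ds *; apply: (one_density_functional_invariant s0 s1 d2 ds).
    by rewrite -d1 ik cl.
  by apply: (density_functional_eq0 s0 s1 st d2 ds _ d1); rewrite ik cl.
have [a ->] := diffop_monomials A.
by rewrite lie_diffop_sum linear_sum big1 // => i ik; rewrite lT.
Qed.

Definition value_at0 (phi : 'I_m -> C) (A : diffop R M m k) : R := diffop_fun A phi 0.

Lemma value_at0_is_linear phi :
  GRing.linear_for *%R (value_at0 phi).
Proof. by []. Qed.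

HB.instance Definition _ phi :=
  GRing.isLinear.Build R (diffop R M m k) R _ (value_at0 phi)
    (value_at0_is_linear phi).

(** Evaluating at 0 on the arguments [s ^+ k], [1], ..., [1] extracts [k]! times the coefficient of
    the multi-index [(k, 0, ..., 0)], because [s ^+ k] vanishes to order [k]. *)
Lemma functional_weight_attained : (0 < m)%N ->
  exists l : {scalar diffop R M m k},
  [/\ forall (X : C) A, X 0 = 0 -> D X 0 = 0 -> l (L X A) = 0,
      forall A, l (L s A) = (delta - k%:R) * l A
    & exists X A, l (L X A) != 0].
Proof.
move=> m0; pose j0 := Ordinal m0.
pose phi (j : 'I_m) : C := if j == j0 then s ^+ k else 1.
pose i0 (j : 'I_m) : nat := if j == j0 then k else 0.
exists (value_at0 phi).
have vE i a : (order i <= k)%N ->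
    value_at0 phi (monomial i a) = a 0 * pderiv i phi 0.
  by move=> ik; rewrite /value_at0 monomialE.
have v0 i a : (order i < k)%N -> value_at0 phi (monomial i a) = 0.
  move=> ik; rewrite vE ?(ltnW ik) // /pderiv (bigD1 j0) //= /phi eqxx.
  have ij : (i j0 < k)%N by rewrite (leq_ltn_trans _ ik) // (bigD1 j0) //= leq_addr.
  set P := \prod_(j < m | _) _.
  rewrite -[LHS]/(a 0 * (iter (i j0) D (s ^+ k) 0 * P 0)) -[s ^+ k]mulr1.
  by rewrite deriv_pow_mul0 ?(ltnW ij) // (ltn_eqF ij) !mul0r mulr0.
have vL X i a : (order i <= k)%N -> value_at0 phi (L X (monomial i a)) =
    (lie_density (delta - k%:R) X a) 0 * pderiv i phi 0.
  move=> ik; rewrite functional_lie_monomial //; last first.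
    by move=> i' b i'i; exact: (v0 _ _ (leq_trans i'i ik)).
  have := ik; rewrite leq_eqVlt => /orP[/eqP ok|ik']; first by rewrite /= vE // ok.
  (* Below order [k] both sides vanish; the coefficient [1] isolates [pderiv i phi 0]. *)
  have := v0 i 1 ik'; rewrite vE // -[(1 : C) 0]/(1 : R) mul1r => ->.
  by rewrite /= v0 // mulr0.
have LE w (X a : C) : lie_density w X a 0 = X 0 * D a 0 + w * (D X 0 * a 0).
  by [].
split.
- move=> X A X0 X1; have [a ->] := diffop_monomials A.
  rewrite lie_diffop_sum linear_sum big1 // => i ik.
  by rewrite /= vL // LE X0 X1 !mul0r mulr0 addr0 mul0r.
- move=> A; have [a ->] := diffop_monomials A.
  rewrite lie_diffop_sum [LHS]linear_sum [X in _ * X]linear_sum mulr_sumr; apply: eq_bigr => i ik.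
  by rewrite /= vL // vE // LE s0 s1 mul0r add0r mul1r mulrA.
- have oi0 : order i0 = k.
    by rewrite (bigD1 j0) //= /i0 eqxx big1 ?addn0 // => j /negPf ->.
  (* Along the field [1] the coefficient [s] becomes [D s], with value 1 at 0, whatever the
     weight. *)
  exists 1, (monomial i0 s).
  rewrite /= vL ?oi0 // LE s0 s1 mulr0 mulr0 addr0 mulr1 mul1r.
  rewrite /pderiv (bigD1 j0) //= big1 => [|j /negPf j0j]; last first.
    by rewrite /i0 /phi j0j.
  rewrite mulr1 /i0 /phi eqxx -[s ^+ k]mulr1 deriv_pow_mul0 // eqxx mul1r.
  by rewrite mulr1 pnatr_eq0 -lt0n fact_gt0.
Qed.

End Functionals.
End Action.

(** The minimal functional on the target pulls back along [T] with the same weight, and surjectivity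
    of [T] keeps it non-invariant, so the lower bound on the source applies. *)
Lemma shift_le (lambda rho : 'I_m -> R) (mu eta : R) : (0 < m)%N ->
  @Vect_isomorphic R M (diffop R M m k) (diffop R M m k)
    (@lie_diffop R M m k lambda mu) (@lie_diffop R M m k rho eta) ->
  mu - \sum_(j < m) lambda j <= eta - \sum_(j < m) rho j.
Proof.
move=> m0 [T [[U TU UT] TL]].
have [s [t [s0 s1 st]]] := smooth_coordinate R M.
have [l [l2 ls [X [A lXA]]]] := functional_weight_attained rho eta s0 s1 m0.
rewrite -(lerD2r (- k%:R)).
apply: (functional_weight_ge s0 s1 st (l := l \o T)) => [Y B Y0 Y1|B|] /=.
- by rewrite TL l2.
- by rewrite TL ls.
- by exists X, (U A); rewrite TL UT.
Qed.

End Operators.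

Lemma Vect_isomorphic_sym (R : realType) (M : curve) (V W : lmodType R)
    (actV : smooth R M -> V -> V) (actW : smooth R M -> W -> W) :
  Vect_isomorphic actV actW -> Vect_isomorphic actW actV.
Proof.
case=> T [[U TU UT] TL].
have Ul : linear U by exact: can2_linear TU UT.
pose U' := GRing.isLinear.Build R W V _ U Ul.
exists (HB.pack U U' : {linear W -> V}); split=> /=; first by exists T.
by move=> X w; apply: (can_inj TU); rewrite TL !UT.
Qed.

Theorem proposition3p3 (R : realType) (M : curve) (m k : nat)
    (lambda rho : 'I_m -> R) (mu eta : R) (hm : (1 <= m)%N)
    (hiso : @Vect_isomorphic R M (diffop R M m k) (diffop R M m k)
              (@lie_diffop R M m k lambda mu) (@lie_diffop R M m k rho eta)) :
  mu - \sum_(j < m) lambda j = eta - \sum_(j < m) rho j.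
Proof.
apply/eqP; rewrite eq_le (shift_le hm hiso) /=.
exact: (shift_le hm (Vect_isomorphic_sym hiso)).
Qed.
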